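(* Let $k$ be a field and let $k\oplus A$ be a connected NQSh bialgebra over $k$, with reduced coproduct $\tilde\Delta:A\to A\otimes A$. Let $\pi:A\to A$ be the unique linear map satisfying $$\mathrm{Id}_A=\pi+\pi\prec\mathrm{Id}_A,\qquad\text{where }\pi\prec \mathrm{Id}_A:=\prec\circ(\pi\otimes\mathrm{Id}_A)\circ\tilde\Delta .$$ Then $\pi$ is a projection onto $Prim(A)=\ker\tilde\Delta$, and for all $x\in Prim(A)$ and $y\in A$, $\pi(x\prec y)=0$.
   Context: NQSh algebra: a nonunital associative algebra $(A,\bullet)$ with two further bilinear products $\prec,\succ$ such that, with $x\star y:=x\prec y+x\succ y+x\bullet y$, for all $x,y,z$: $(x\prec y)\prec z=x\prec(y\star z)$; $(x\succ y)\prec z=x\succ(y\prec z)$; $(x\star y)\succ z=x\succ(y\succ z)$; $(x\prec y)\bullet z=x\bullet(y\succ z)$; $(x\succ y)\bullet z=x\succ(y\bullet z)$; $(x\bullet y)\prec z=x\bullet(y\prec z)$. NQSh bialgebra: $k\oplus A$, with $A$ an NQSh algebra and $1$ a unit for $\star$, with a coassociative counital coproduct $\Delta$, $\Delta(1)=1\otimes 1$, such that, with $\tilde\Delta(a)=\Delta(a)-a\otimes1-1\otimes a=:a'\otimes a''\in A\otimes A$ for $a\in A$, for all $x,y\in A$: $\tilde\Delta(x\prec y)=x'\prec y'\otimes x''\star y''+x'\otimes x''\star y+x\prec y'\otimes y''+x'\prec y\otimes x''+x\otimes y$; $\tilde\Delta(x\succ y)=x'\succ y'\otimes x''\star y''+y'\otimes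 x\star y''+x\succ y'\otimes y''+x'\succ y\otimes x''+y\otimes x$; $\tilde\Delta(x\bullet y)=x'\bullet y'\otimes x''\star y''+x'\bullet y\otimes x''+x\bullet y'\otimes y''$. Connected: $A=\bigcup_{n\ge1}\ker\tilde\Delta^{(n)}$, where $\tilde\Delta^{(1)}=\tilde\Delta$ and $\tilde\Delta^{(n)}:A\to A^{\otimes(n+1)}$ is the iterated reduced coproduct. (Under this assumption $\pi$ exists and is unique.) *)

(* Defs.v *)
(* [boolp] is used to decide the Prop-valued congruence defining the tensor product. *)
From HB Require Import structures.
From mathcomp Require Import all_boot all_order all_algebra.
From mathcomp Require Import boolp.

Set Implicit Arguments.
Unset Strict Implicit.
Unset Printing Implicit Defensive.

Import GRing.Theory.
Local Open Scope ring_scope.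
Local Open Scope quotient_scope.

Reserved Notation "x ⊗ y" (at level 40, left associativity).
Reserved Notation "'\sweedler_' ( a , b <- t ) E"
  (at level 41, a name, b name, E at level 41, right associativity,
   format "'\sweedler_' ( a ,  b  <-  t )  E").
Reserved Notation "x ≺ y" (at level 40, left associativity).
Reserved Notation "x ≻ y" (at level 40, left associativity).
Reserved Notation "x • y" (at level 40, left associativity).
Reserved Notation "x ⋆ y" (at level 40, left associativity).

(* The tensor product U ⊗ V of two vector spaces of arbitrary dimension: finite
   formal sums of pairs (u, v), represented by lists, modulo the congruence
   generated by commutativity and the bilinearity relations. *)
Section Tensor.
Variables (k : fieldType) (U V : lmodType k).
Implicit Types (s t : seq (U * V)) (u : U) (v : V).

Inductive tensor_eq : seq (U * V) -> seq (U * V) -> Prop :=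
| TensorRefl s : tensor_eq s s
| TensorSym s t : tensor_eq s t -> tensor_eq t s
| TensorTrans s t r : tensor_eq s t -> tensor_eq t r -> tensor_eq s r
| TensorCat s s' t t' :
    tensor_eq s s' -> tensor_eq t t' -> tensor_eq (s ++ t) (s' ++ t')
| TensorC s t : tensor_eq (s ++ t) (t ++ s)
| Tensor0 v : tensor_eq [:: (0, v)] [::]
| TensorDl u u' v : tensor_eq [:: (u + u', v)] [:: (u, v); (u', v)]
| TensorDr u v v' : tensor_eq [:: (u, v + v')] [:: (u, v); (u, v')]
| TensorZ (c : k) u v : tensor_eq [:: (c *: u, v)] [:: (u, c *: v)].

Definition tensor_eqb : rel (seq (U * V)) := fun s t => `[< tensor_eq s t >].

Lemma tensor_eqb_refl : reflexive tensor_eqb.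
Proof. by move=> s; apply/asboolP; exact: TensorRefl. Qed.

Lemma tensor_eqb_sym : symmetric tensor_eqb.
Proof. by move=> s t; apply/asboolP/asboolP; exact: TensorSym. Qed.

Lemma tensor_eqb_trans : transitive tensor_eqb.
Proof.
by move=> t s r /asboolP st /asboolP tr; apply/asboolP; exact: TensorTrans st tr.
Qed.

Canonical tensor_equiv :=
  EquivRel tensor_eqb tensor_eqb_refl tensor_eqb_sym tensor_eqb_trans.

Definition tensor : Type := {eq_quot tensor_equiv}.
HB.instance Definition _ := Choice.copy tensor {eq_quot tensor_equiv}.

Definition tpi (s : seq (U * V)) : tensor := \pi_({eq_quot tensor_equiv}) s.
Definition trepr (x : tensor) : seq (U * V) :=
  repr (x : {eq_quot tensor_equiv}).

Lemma treprK x : tpi (trepr x) = x.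
Proof. exact: reprK. Qed.

Lemma tpiP s t : tensor_eq s t <-> tpi s = tpi t.
Proof.
split=> [st|].
  by apply/eqmodP/asboolP.
by move/eqmodP/asboolP.
Qed.

Lemma trepr_pi s : tensor_eq (trepr (tpi s)) s.
Proof. by apply/tpiP; rewrite treprK. Qed.

Definition tensor_add (x y : tensor) : tensor := tpi (trepr x ++ trepr y).
Definition tensor_scale (c : k) (x : tensor) : tensor :=
  tpi [seq (c *: p.1, p.2) | p <- trepr x].

Lemma tensor_addE s t : tensor_add (tpi s) (tpi t) = tpi (s ++ t).
Proof. by apply/tpiP/TensorCat; exact: trepr_pi. Qed.

Lemma tensor_eq_scale (c : k) s t : tensor_eq s t ->
  tensor_eq [seq (c *: p.1, p.2) | p <- s] [seq (c *: p.1, p.2) | p <- t].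
Proof.
elim=> {s t}.
- by move=> s; exact: TensorRefl.
- by move=> s t _; exact: TensorSym.
- by move=> s t r _ st _; exact: TensorTrans.
- by move=> s s' t t' _ ss' _ tt'; rewrite !map_cat; exact: TensorCat.
- by move=> s t; rewrite !map_cat; exact: TensorC.
- by move=> v /=; rewrite scaler0; exact: Tensor0.
- by move=> u u' v /=; rewrite scalerDr; exact: TensorDl.
- by move=> u v v' /=; exact: TensorDr.
- by move=> d u v /=; rewrite scalerA mulrC -scalerA; exact: TensorZ.
Qed.

Lemma tensor_scaleE (c : k) s :
  tensor_scale c (tpi s) = tpi [seq (c *: p.1, p.2) | p <- s].
Proof. by apply/tpiP/tensor_eq_scale/trepr_pi. Qed.

Lemma tensor_addA : associative tensor_add.
Proof.
move=> x y z; rewrite -(treprK x) -(treprK y) -(treprK z).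
by rewrite !tensor_addE catA.
Qed.

Lemma tensor_addC : commutative tensor_add.
Proof.
move=> x y; rewrite -(treprK x) -(treprK y) !tensor_addE.
exact/tpiP/TensorC.
Qed.

Lemma tensor_add0 : left_id (tpi [::]) tensor_add.
Proof. by move=> x; rewrite -(treprK x) tensor_addE. Qed.

Lemma tensor_addN :
  left_inverse (tpi [::]) (tensor_scale (-1)) tensor_add.
Proof.
move=> x; rewrite -(treprK x) tensor_scaleE.
elim: (trepr x) => [|[u v] s IHs] /=; first by rewrite tensor_addE.
set s' := [seq _ | _ <- s] in IHs *.
rewrite -cat1s -[(u, v) :: s]cat1s -!tensor_addE [tensor_add _ (tpi s')]tensor_addC.
rewrite -tensor_addA (tensor_addA (tpi [:: _])).
have -> : tensor_add (tpi [:: (-1 *: u, v)]) (tpi [:: (u, v)]) = tpi [::].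
  rewrite tensor_addE; apply/tpiP.
  apply: TensorTrans (TensorSym (TensorDl _ _ _)) _.
  by rewrite scaleN1r addNr; exact: Tensor0.
by rewrite tensor_add0.
Qed.

HB.instance Definition _ := GRing.isZmodule.Build tensor
  tensor_addA tensor_addC tensor_add0 tensor_addN.

Lemma tpi_cat s t : tpi (s ++ t) = tpi s + tpi t.
Proof. by rewrite -tensor_addE. Qed.

Lemma tensor_scaleA (a b : k) (x : tensor) :
  tensor_scale a (tensor_scale b x) = tensor_scale (a * b) x.
Proof.
rewrite -(treprK x) !tensor_scaleE -map_comp; congr tpi.
by apply: eq_map => p /=; rewrite scalerA.
Qed.

Lemma tensor_scale1 : left_id 1 tensor_scale.
Proof.
move=> x; rewrite -(treprK x) tensor_scaleE; congr tpi.
by rewrite -[RHS]map_id; apply: eq_map => -[u v] /=; rewrite scale1r.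
Qed.

Lemma tensor_scaleDr : right_distributive tensor_scale +%R.
Proof.
move=> a x y; rewrite -(treprK x) -(treprK y).
by rewrite -tpi_cat !tensor_scaleE map_cat tpi_cat.
Qed.

Lemma tensor_scaleDl (x : tensor) :
  {morph tensor_scale^~ x : a b / a + b}.
Proof.
move=> a b; rewrite -(treprK x) !tensor_scaleE.
elim: (trepr x) => [|[u v] s IHs] /=; first by rewrite -tpi_cat.
rewrite -cat1s -[(a *: u, v) :: _]cat1s -[(b *: u, v) :: _]cat1s.
rewrite !tpi_cat IHs addrACA; congr (_ + _).
by rewrite -tpi_cat; apply/tpiP; rewrite scalerDl; exact: TensorDl.
Qed.

HB.instance Definition _ := GRing.Zmodule_isLmodule.Build k tensor
  tensor_scaleA tensor_scale1 tensor_scaleDr tensor_scaleDl.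

Definition tens (u : U) (v : V) : tensor := tpi [:: (u, v)].

Lemma tpi_sum s : tpi s = \sum_(p <- s) tens p.1 p.2.
Proof.
elim: s => [|[u v] s IHs]; first by rewrite big_nil.
by rewrite big_cons -IHs -cat1s tpi_cat.
Qed.

Lemma tens_bilinear : bilinear_for *:%R *:%R tens.
Proof.
have tensZ (c : k) u v : tens (c *: u) v = c *: tens u v.
  by rewrite -[RHS]/(tensor_scale c (tpi [:: (u, v)])) tensor_scaleE.
split=> [v c u u'|u c v v'] /=.
  rewrite -tensZ /tens -tpi_cat; apply/tpiP; exact: TensorDl.
rewrite -tensZ /tens -tpi_cat.
apply/tpiP; apply: TensorTrans (TensorDr _ _ _) _.
apply: (@TensorCat [:: _] [:: _] [:: _] [:: _]).
  exact/TensorSym/TensorZ.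
exact: TensorRefl.
Qed.

HB.instance Definition _ :=
  bilinear_isBilinear.Build k U V tensor *:%R *:%R tens tens_bilinear.

(* The linear map U ⊗ V -> W induced by a map f : U -> V -> W. It depends on the
   choice of representatives unless f is bilinear; it is only used on bilinear
   maps, for which it is characterized by the three lemmas that follow. *)
Definition tlift (W : lmodType k) (f : U -> V -> W) (x : tensor) : W :=
  \sum_(p <- trepr x) f p.1 p.2.

Section Universal.
Variables (W : lmodType k) (f : U -> V -> W).
Hypothesis f_bilin : bilinear_for *:%R *:%R f.

Lemma tlift_pi s : tlift f (tpi s) = \sum_(p <- s) f p.1 p.2.
Proof.
have [g fg] : exists g : {bilinear U -> V -> W}, forall u v, f u v = g u v.
  pose g : {bilinear U -> V -> W} := HB.pack f
    (bilinear_isBilinear.Build k U V W *:%R *:%R f f_bilin).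
  by exists g.
rewrite /tlift; move: (trepr_pi s); move: (trepr _) => r; elim=> {r s}.
- by [].
- by move=> s t _ ->.
- by move=> s t r _ -> _ ->.
- by move=> s s' t t' _ ss' _ tt'; rewrite !big_cat /= ss' tt'.
- by move=> s t; rewrite !big_cat /= addrC.
- by move=> v; rewrite big_seq1 big_nil fg linear0l.
- by move=> u u' v; rewrite !big_cons !big_nil !fg /= linearDl !addr0.
- by move=> u v v'; rewrite !big_cons !big_nil !fg /= linearDr !addr0.
- by move=> c u v; rewrite !big_seq1 !fg /= linearZl_LR linearZr_LR.
Qed.

Lemma tliftE u v : tlift f (tens u v) = f u v.
Proof. by rewrite /tens tlift_pi big_seq1. Qed.

Lemma tlift_linear : linear (tlift f).
Proof.
move=> c x y; rewrite -(treprK x) -(treprK y).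
rewrite -[c *: _]/(tensor_scale c _) tensor_scaleE -tpi_cat !tlift_pi.
rewrite big_cat /= big_map scaler_sumr; congr (_ + _).
by apply: eq_bigr => p _ /=; have /= := f_bilin.1 p.2 c p.1 0;
  rewrite addr0 => ->; have /= := f_bilin.1 p.2 (-1) 0 0;
  rewrite scaler0 addr0 scaleN1r addNr => ->; rewrite addr0.
Qed.

Lemma tlift_unique (h : {linear tensor -> W}) :
  (forall u v, h (tens u v) = f u v) -> h =1 tlift f.
Proof.
move=> hE x; rewrite -(treprK x) tlift_pi tpi_sum raddf_sum.
by apply: eq_bigr => p _; exact: hE.
Qed.

End Universal.
End Tensor.

Arguments tensor {k} (U V)%_type.

Notation "U ⊗ V" := (tensor U V) : type_scope.
Notation "u ⊗ v" := (tens u v) : ring_scope.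
Notation "'\sweedler_' ( a , b <- t ) E" := (tlift (fun a b => E) t) : ring_scope.

Definition tmap (k : fieldType) (U V U' V' : lmodType k)
    (f : U -> U') (g : V -> V') (t : U ⊗ V) : (U' ⊗ V')%type :=
  \sweedler_(u, v <- t) (f u ⊗ g v).

Definition tassoc (k : fieldType) (U V W : lmodType k) (t : (U ⊗ V) ⊗ W) :
    (U ⊗ (V ⊗ W))%type :=
  \sweedler_(uv, w <- t) \sweedler_(u, v <- uv) (u ⊗ (v ⊗ w)).

Section TensorMaps.
Variable k : fieldType.

Lemma tmap_bilinear (U V U' V' : lmodType k)
    (f : {linear U -> U'}) (g : {linear V -> V'}) :
  bilinear_for *:%R *:%R (fun u v => f u ⊗ g v).
Proof.
split=> [v c u u'|u c v v'] /=; first by rewrite linearP linearPl.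
by rewrite linearP linearPr.
Qed.

Lemma tmap_linear (U V U' V' : lmodType k)
    (f : {linear U -> U'}) (g : {linear V -> V'}) : linear (tmap f g).
Proof. exact/tlift_linear/tmap_bilinear. Qed.

Lemma tmapE (U V U' V' : lmodType k)
    (f : {linear U -> U'}) (g : {linear V -> V'}) (u : U) (v : V) :
  tmap f g (u ⊗ v) = f u ⊗ g v.
Proof. exact/tliftE/tmap_bilinear. Qed.

Lemma tassoc_bilinear1 (U V W : lmodType k) (w : W) :
  bilinear_for *:%R *:%R (fun (u : U) (v : V) => u ⊗ (v ⊗ w)).
Proof.
split=> [v c u u'|u c v v'] /=; first by rewrite linearPl.
by rewrite linearPl linearPr.
Qed.

Lemma tassoc_bilinear (U V W : lmodType k) :
  bilinear_for *:%R *:%R (fun (uv : U ⊗ V) (w : W) =>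
    \sweedler_(u, v <- uv) (u ⊗ (v ⊗ w))).
Proof.
split=> [w|uv c w w'] /=; first exact/tlift_linear/tassoc_bilinear1.
rewrite /tlift scaler_sumr -big_split /=; apply: eq_bigr => p _.
by rewrite !linearPr.
Qed.

Lemma tassoc_linear (U V W : lmodType k) : linear (@tassoc k U V W).
Proof. exact/tlift_linear/tassoc_bilinear. Qed.

Lemma tassocE (U V W : lmodType k) (u : U) (v : V) (w : W) :
  tassoc ((u ⊗ v) ⊗ w) = u ⊗ (v ⊗ w).
Proof.
rewrite /tassoc tliftE; last exact: tassoc_bilinear.
by rewrite tliftE; last exact: tassoc_bilinear1.
Qed.

End TensorMaps.

Definition sum3 (k : fieldType) (A : lmodType k) (p s b : A -> A -> A) :
  A -> A -> A := fun x y => p x y + s x y + b x y.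

HB.mixin Record isNQSh (k : fieldType) A of GRing.Lmodule k A := {
  prec : {bilinear A -> A -> A};
  succ : {bilinear A -> A -> A};
  bullet : {bilinear A -> A -> A};
  bulletA : associative bullet;
  prec_prec : forall x y z : A,
    prec (prec x y) z = prec x (sum3 prec succ bullet y z);
  succ_prec : forall x y z : A, prec (succ x y) z = succ x (prec y z);
  star_succ : forall x y z : A,
    succ (sum3 prec succ bullet x y) z = succ x (succ y z);
  prec_bullet : forall x y z : A, bullet (prec x y) z = bullet x (succ y z);
  succ_bullet : forall x y z : A, bullet (succ x y) z = succ x (bullet y z);
  bullet_prec : forall x y z : A, prec (bullet x y) z = bullet x (prec y z)
}.

#[short(type="nqshAlgType")]
HB.structure Definition NQSh (k : fieldType) :=
  {A of isNQSh k A & GRing.Lmodule k A}.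

Definition star (k : fieldType) (A : nqshAlgType k) : A -> A -> A :=
  sum3 (@prec k A) (@succ k A) (@bullet k A).

Notation "x ≺ y" := (prec x y) : ring_scope.
Notation "x ≻ y" := (succ x y) : ring_scope.
Notation "x • y" := (bullet x y) : ring_scope.
Notation "x ⋆ y" := (star x y) : ring_scope.

Lemma starE (k : fieldType) (A : nqshAlgType k) (x y : A) :
  x ⋆ y = x ≺ y + x ≻ y + x • y.
Proof. by []. Qed.

Section UnitExtension.
Variables (k : fieldType) (A : lmodType k).

Definition uext : lmodType k := (k^o * A)%type.
Definition uext1 : uext := (1, 0).
Definition uext_in (a : A) : uext := (0, a).

Lemma uext_in_linear : linear uext_in.
Proof.
move=> c a b; rewrite /uext_in; congr pair.
by rewrite -[LHS]/(0 : k^o) /= scaler0 addr0.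
Qed.

HB.instance Definition _ :=
  GRing.isLinear.Build k A uext *:%R uext_in uext_in_linear.

End UnitExtension.

Arguments uext1 {k A}.

(* The product ⋆ of A, extended to k ⊕ A so that 1 is a unit. *)
Definition uext_star (k : fieldType) (A : nqshAlgType k) (x y : uext A) :
    uext A :=
  (x.1 * y.1, x.1 *: y.2 + y.1 *: x.2 + x.2 ⋆ y.2).

Section UnitExtensionStar.
Variables (k : fieldType) (A : nqshAlgType k).

Lemma uext_star_in (a b : A) :
  uext_star (uext_in a) (uext_in b) = uext_in (a ⋆ b).
Proof. by rewrite /uext_star /= mul0r !scale0r !add0r. Qed.

Lemma uext_star1l (x : uext A) : uext_star uext1 x = x.
Proof.
case: x => c a; rewrite /uext_star starE /= mul1r scale1r scaler0 addr0.
by rewrite !linear0l !addr0.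
Qed.

Lemma uext_star1r (x : uext A) : uext_star x uext1 = x.
Proof.
case: x => c a; rewrite /uext_star starE /= mulr1 scale1r scaler0 add0r.
by rewrite !linear0r !addr0.
Qed.

End UnitExtensionStar.

(* Besides the coproduct Δ of k ⊕ A, the structure records its reduced coproduct
   A -> A ⊗ A, which [coprod_in] determines since A ⊗ A embeds in
   (k ⊕ A) ⊗ (k ⊕ A). *)
HB.mixin Record isNQShBialgebra (k : fieldType) A of NQSh k A := {
  coprod : {linear uext A -> (uext A ⊗ uext A)%type};
  counit : {scalar (uext A)};
  redcop : {linear A -> (A ⊗ A)%type};
  coprod_coassoc : forall x : uext A,
    tassoc (tmap coprod idfun (coprod x)) = tmap idfun coprod (coprod x);
  coprod_counitl : forall x : uext A,
    \sweedler_(u, v <- coprod x) (counit u *: v) = x;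
  coprod_counitr : forall x : uext A,
    \sweedler_(u, v <- coprod x) (counit v *: u) = x;
  coprod1 : coprod uext1 = uext1 ⊗ uext1;
  coprod_in : forall a : A,
    coprod (uext_in a) - uext_in a ⊗ uext1 - uext1 ⊗ uext_in a
    = tmap (@uext_in k A) (@uext_in k A) (redcop a);
  redcop_prec : forall x y : A, redcop (x ≺ y) =
      \sweedler_(x1, x2 <- redcop x) \sweedler_(y1, y2 <- redcop y)
        ((x1 ≺ y1) ⊗ (x2 ⋆ y2))
    + \sweedler_(x1, x2 <- redcop x) (x1 ⊗ (x2 ⋆ y))
    + \sweedler_(y1, y2 <- redcop y) ((x ≺ y1) ⊗ y2)
    + \sweedler_(x1, x2 <- redcop x) ((x1 ≺ y) ⊗ x2)
    + x ⊗ y;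
  redcop_succ : forall x y : A, redcop (x ≻ y) =
      \sweedler_(x1, x2 <- redcop x) \sweedler_(y1, y2 <- redcop y)
        ((x1 ≻ y1) ⊗ (x2 ⋆ y2))
    + \sweedler_(y1, y2 <- redcop y) (y1 ⊗ (x ⋆ y2))
    + \sweedler_(y1, y2 <- redcop y) ((x ≻ y1) ⊗ y2)
    + \sweedler_(x1, x2 <- redcop x) ((x1 ≻ y) ⊗ x2)
    + y ⊗ x;
  redcop_bullet : forall x y : A, redcop (x • y) =
      \sweedler_(x1, x2 <- redcop x) \sweedler_(y1, y2 <- redcop y)
        ((x1 • y1) ⊗ (x2 ⋆ y2))
    + \sweedler_(x1, x2 <- redcop x) ((x1 • y) ⊗ x2)
    + \sweedler_(y1, y2 <- redcop y) ((x • y1) ⊗ y2)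
}.

(* An [A : nqshBialgType k] is the augmentation ideal A of an NQSh bialgebra
   k ⊕ A. *)
#[short(type="nqshBialgType")]
HB.structure Definition NQShBialgebra (k : fieldType) :=
  {A of isNQShBialgebra k A & NQSh k A}.

(* [tpow A n] is the tensor power of A with n.+1 factors. *)
Fixpoint tpow (k : fieldType) (A : lmodType k) (n : nat) : lmodType k :=
  if n is m.+1 then (tpow A m ⊗ A)%type else A.

(* [itercop n] is the iterated reduced coproduct with upper index n.+1, so that
   [itercop 0] is the reduced coproduct itself. *)
Fixpoint itercop (k : fieldType) (A : nqshBialgType k) (n : nat) :
    A -> tpow A n.+1 :=
  if n is m.+1 then fun x => tmap (@itercop k A m) idfun (redcop x)
  else fun x => redcop x.

Definition connected (k : fieldType) (A : nqshBialgType k) : Prop :=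
  forall x : A, exists n : nat, itercop n x = 0.

Definition primitive (k : fieldType) (A : nqshBialgType k) (x : A) : Prop :=
  redcop x = 0.

Definition conv_prec (k : fieldType) (A : nqshBialgType k) (f g : A -> A)
    (x : A) : A :=
  \sweedler_(x1, x2 <- redcop x) (f x1 ≺ g x2).

Definition projection_onto (k : fieldType) (A : lmodType k) (p : A -> A)
    (P : A -> Prop) : Prop :=
  (forall x, p (p x) = p x) /\ (forall x, P x <-> exists y, x = p y).

(* Main.v *)
(** The coproduct formula for [≺] splits, for any [p] and [y], as
    [Δ~(p ≺ y) = Φ(Δ~ p, y) + (p ≺ y') ⊗ y'' + p ⊗ y] with [Φ] bilinear.
    Substituting [x = π x + π x' ≺ x''] into [Δ~ x] and using coassociativity,
    everything cancels except [Δ~ (π x) = - Φ(Δ~ (π x'), x'')].  A linear map [g]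
    obeying such a recursion [g x = φ(g x', x'')] factors through every iterated
    reduced coproduct, hence vanishes by connectedness; so [π x] is primitive.
    For [x] primitive, [y |-> π (x ≺ y)] obeys the recursion
    [π (x ≺ y) = - π (x ≺ y') ≺ y''] and vanishes for the same reason. *)
Require Import Defs.
From HB Require Import structures.
From mathcomp Require Import all_boot all_order all_algebra.
Import GRing.Theory.
Local Open Scope ring_scope.

(** * Calculus of linear maps out of tensor products *)

Section SweedlerCalculus.
Set Implicit Arguments.
Unset Strict Implicit.
Context {k : fieldType}.

Lemma eq_tlift (U V W : lmodType k) (f g : U -> V -> W) (t : (U ⊗ V)%type) :
  (forall u v, f u v = g u v) -> tlift f t = tlift g t.
Proof. by move=> fg; apply: eq_bigr. Qed.

(** [tlift] is a finite sum over one chosen representative of [t], hence additive in its map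
    argument for arbitrary maps. *)
Lemma tliftD (U V W : lmodType k) (f g : U -> V -> W) (t : (U ⊗ V)%type) :
  tlift (fun u v => f u v + g u v) t = tlift f t + tlift g t.
Proof. exact: big_split. Qed.

Lemma tliftN (U V W : lmodType k) (f : U -> V -> W) (t : (U ⊗ V)%type) :
  tlift (fun u v => - f u v) t = - tlift f t.
Proof. exact: sumrN. Qed.

Lemma tliftP (U V W : lmodType k) (c : k) (f g : U -> V -> W)
    (t : (U ⊗ V)%type) :
  tlift (fun u v => c *: f u v + g u v) t = c *: tlift f t + tlift g t.
Proof. by rewrite tliftD /tlift scaler_sumr. Qed.

(** Linearity is a plain proposition here, so that raw maps such as [tlift f] can be passed together
    with their linearity lemmas. *)
Lemma linear_tlift (W X : lmodType k) (L : W -> X) (linL : linear L)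
    (U V : lmodType k) (f : U -> V -> W) (t : (U ⊗ V)%type) :
  L (tlift f t) = tlift (fun u v => L (f u v)) t.
Proof.
pose L' : {linear W -> X} :=
  HB.pack L (GRing.isLinear.Build k W X *:%R L linL).
by rewrite -[LHS]/(L' _) /tlift linear_sum.
Qed.

Lemma scalerD3 (V : lmodType k) (c : k) (x y z x' y' z' : V) :
  c *: x + x' + (c *: y + y') + (c *: z + z')
  = c *: (x + y + z) + (x' + y' + z').
Proof. by rewrite !scalerDr (addrACA (c *: x + c *: y)) (addrACA (c *: x)). Qed.

Lemma tlift_additive (U V W : lmodType k) (f : U -> V -> W)
    (s t : (U ⊗ V)%type) :
  bilinear_for *:%R *:%R f -> tlift f (s + t) = tlift f s + tlift f t.
Proof. by move=> bf; rewrite -{1}[s]scale1r tlift_linear // scale1r. Qed.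

Lemma tlift0 (U V W : lmodType k) (f : U -> V -> W) :
  bilinear_for *:%R *:%R f -> tlift f 0 = 0.
Proof.
move=> bf; have := tlift_linear bf (-1) 0 0.
by rewrite scaler0 addr0 scaleN1r addNr.
Qed.

Lemma tlift_tens (U V : lmodType k) (t : (U ⊗ V)%type) :
  \sweedler_(u, v <- t) (u ⊗ v) = t.
Proof. by rewrite /tlift -tpi_sum treprK. Qed.

Lemma tlift_tmap (U V U' V' W : lmodType k) (f : U' -> V' -> W)
    (g : U -> U') (h : V -> V') (t : (U ⊗ V)%type) :
  bilinear_for *:%R *:%R f ->
  tlift f (tmap g h t) = \sweedler_(u, v <- t) f (g u) (h v).
Proof.
move=> bf; rewrite /tmap (linear_tlift (tlift_linear bf)).
by apply: eq_tlift => u v; rewrite tliftE.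
Qed.

Lemma tmap_comp (U V U' V' U2 V2 : lmodType k)
    (f : {linear U' -> U2}) (g : {linear V' -> V2})
    (f' : U -> U') (g' : V -> V') (t : (U ⊗ V)%type) :
  tmap f g (tmap f' g' t) = tmap (f \o f') (g \o g') t.
Proof. exact/tlift_tmap/tmap_bilinear. Qed.

HB.instance Definition _ (U V U' V' : lmodType k)
    (f : {linear U -> U'}) (g : {linear V -> V'}) :=
  GRing.isLinear.Build k (U ⊗ V)%type (U' ⊗ V')%type *:%R (tmap f g)
    (tmap_linear f g).

Lemma tassoc_tmap (U V W U' V' W' : lmodType k) (f : {linear U -> U'})
    (g : {linear V -> V'}) (h : {linear W -> W'}) (t : ((U ⊗ V) ⊗ W)%type) :
  tassoc (tmap (tmap f g) h t) = tmap f (tmap g h) (tassoc t).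
Proof.
rewrite /tassoc tlift_tmap; last exact: tassoc_bilinear.
rewrite [RHS](linear_tlift (tmap_linear _ _)).
apply: eq_tlift => uv w.
rewrite tlift_tmap; last exact: tassoc_bilinear1.
rewrite [RHS](linear_tlift (tmap_linear _ _)).
by apply: eq_tlift => u v; rewrite tmapE /= tmapE.
Qed.

End SweedlerCalculus.

(** * Coassociativity of the reduced coproduct, and vanishing by connectedness *)

Section ReducedCoproduct.
Set Implicit Arguments.
Unset Strict Implicit.
Context {k : fieldType} {A : nqshBialgType k}.

Definition uext_proj (z : uext A) : A := z.2.
Arguments uext_proj : simpl never.

Lemma uext_proj_linear : linear uext_proj.
Proof. by []. Qed.

HB.instance Definition _ :=
  GRing.isLinear.Build k (uext A) A *:%R uext_proj uext_proj_linear.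

(** The projection kills [uext1], hence also the terms [a ⊗ 1], [1 ⊗ a] and [1 ⊗ 1] by which the two
    coproducts differ. This is what carries coassociativity from [coprod] down to [redcop]. *)
Lemma redcop_proj (z : uext A) :
  redcop (uext_proj z) = tmap uext_proj uext_proj (coprod z).
Proof.
have p1 : uext_proj uext1 = 0 by [].
have copin (a : A) : tmap uext_proj uext_proj (coprod (uext_in a)) = redcop a.
  have copE : coprod (uext_in a) = tmap (@uext_in k A) (@uext_in k A) (redcop a)
      + uext1 ⊗ uext_in a + uext_in a ⊗ uext1.
    have /eqP := coprod_in a; rewrite !subr_eq => /eqP; exact.
  rewrite copE !linearD /= !tmapE /= p1 linear0r linear0l !addr0.
  by rewrite tmap_comp; exact: tlift_tens.
have zE : z = z.1 *: uext1 + uext_in z.2.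
  case: z => c a; rewrite /uext1 /uext_in.
  by congr pair; rewrite /= ?addr0 ?scaler0 ?add0r //; rewrite /GRing.scale /= mulr1.
by rewrite [in RHS]zE !linearP /= coprod1 tmapE /= p1 linear0l scaler0 add0r copin.
Qed.

(** By [redcop_proj], both sides are images of the two sides of [coprod_coassoc] under the threefold
    tensor power of the projection. *)
Lemma redcop_coassoc (x : A) :
  tassoc (tmap redcop idfun (redcop x)) = tmap idfun redcop (redcop x).
Proof.
have -> : redcop x = tmap uext_proj uext_proj (coprod (uext_in x)).
  by rewrite -redcop_proj.
rewrite !tmap_comp.
have -> : tmap (redcop \o uext_proj) (idfun \o uext_proj) (coprod (uext_in x))
        = tmap (tmap uext_proj uext_proj) uext_proj
            (tmap coprod idfun (coprod (uext_in x))).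
  rewrite tmap_comp; apply: eq_tlift => u v /=; by rewrite redcop_proj.
rewrite tassoc_tmap coprod_coassoc tmap_comp.
by apply: eq_tlift => u v /=; rewrite redcop_proj.
Qed.

Lemma redcop_coassoc_bilinear (W : lmodType k)
    (m : {bilinear A -> A -> W}) (x : A) :
  \sweedler_(a, b <- redcop x) \sweedler_(b1, b2 <- redcop b) (m a b1 ⊗ b2)
  = \sweedler_(a, b <- redcop x)
      ((\sweedler_(a1, a2 <- redcop a) m a1 a2) ⊗ b).
Proof.
have bil1 a : bilinear_for *:%R *:%R (fun b1 b2 : A => m a b1 ⊗ b2).
  by split=> [b2 c b1 b1'|b1 c b2 b2'] /=; rewrite ?linearPr ?linearPl.
have bil2 : bilinear_for *:%R *:%R
    (fun a (t : (A ⊗ A)%type) => \sweedler_(b1, b2 <- t) (m a b1 ⊗ b2)).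
  split=> [t c a a'|a c t t'] /=; last exact: tlift_linear.
  by rewrite -tliftP; apply: eq_tlift => b1 b2; rewrite !linearPl.
(* The left side is a linear map applied to [tmap idfun redcop (redcop x)], the form in which
   coassociativity applies. *)
rewrite -[LHS](tlift_tmap idfun redcop (redcop x) bil2) -redcop_coassoc /tassoc.
rewrite (linear_tlift (tlift_linear bil2)).
rewrite tlift_tmap; last first.
  split=> [w c t t'|t c w w'] /=.
    have /= -> := (tassoc_bilinear _ _ _).1 w c t t'; exact: tlift_linear.
  have /= -> := (tassoc_bilinear _ _ _).2 t c w w'; exact: tlift_linear.
apply: eq_tlift => a b.
rewrite (linear_tlift (tlift_linear bil2)).
have linb : linear (fun w : W => w ⊗ b) by move=> c w w'; rewrite linearPl.
rewrite (linear_tlift linb).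
by apply: eq_tlift => a1 a2; rewrite !tliftE.
Qed.

Lemma star_bilinear : bilinear_for *:%R *:%R (@star k A).
Proof.
split=> [y c x x'|x c y y'] /=; rewrite !starE.
  by rewrite !linearPl scalerD3.
by rewrite !linearPr scalerD3.
Qed.

HB.instance Definition _ :=
  bilinear_isBilinear.Build k A A A *:%R *:%R (@star k A) star_bilinear.

(** The recursion feeds [g] back into the left leg, the one on which [itercop] iterates. Unfolding
    it [n.+1] times thus exhibits [g] as a linear map after [itercop n]. *)
Lemma connected_recursion0 (W : lmodType k) (phi : W -> A -> W)
    (g : {linear A -> W}) :
  connected A -> bilinear_for *:%R *:%R phi ->
  (forall x, g x = \sweedler_(a, b <- redcop x) phi (g a) b) ->
  forall x, g x = 0.
Proof.
move=> conA bphi grec x.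
have factor n : exists psi : {linear tpow A n.+1 -> W},
    forall z, g z = psi (itercop n z).
  (* One unfolding: [f] is [g] itself in the base case and the previous [psi] afterwards. *)
  have lift (V : lmodType k) (f : {linear V -> W}) :
      exists psi : {linear (V ⊗ A)%type -> W}, forall v b,
        psi (v ⊗ b) = phi (f v) b.
    have bil : bilinear_for *:%R *:%R (fun v b => phi (f v) b).
      split=> [b c v v'|v c b b'] /=; first by rewrite linearP bphi.1.
      by rewrite bphi.2.
    pose psi : {linear (V ⊗ A)%type -> W} := HB.pack
      (tlift (fun v b => phi (f v) b))
      (GRing.isLinear.Build k (V ⊗ A)%type W *:%R _ (tlift_linear bil)).
    by exists psi => v b; exact: tliftE.
  elim: n => [|n [psi gpsi]].
    have [psi' psi'E] := lift A g.
    exists psi' => z; rewrite grec /= -{2}[redcop z]tlift_tens.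
    rewrite (linear_tlift (linearP psi')).
    by apply: eq_tlift => a b; rewrite psi'E.
  have [psi' psi'E] := lift _ psi.
  exists psi' => z; rewrite grec /= /tmap.
  rewrite (linear_tlift (linearP psi')).
  by apply: eq_tlift => a b; rewrite psi'E gpsi.
have [n xn0] := conA x; have [psi ->] := factor n.
by rewrite xn0 linear0.
Qed.

(** The map Φ of the overview on [x1 ⊗ x2]: it gathers the three terms of [redcop_prec] that involve
    the legs of [redcop x]. *)
Definition prec_rest (y x1 x2 : A) : (A ⊗ A)%type :=
  \sweedler_(y1, y2 <- redcop y) ((x1 ≺ y1) ⊗ (x2 ⋆ y2))
  + x1 ⊗ (x2 ⋆ y) + (x1 ≺ y) ⊗ x2.

Lemma redcop_precE (x y : A) : redcop (x ≺ y) =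
  \sweedler_(x1, x2 <- redcop x) prec_rest y x1 x2
  + \sweedler_(y1, y2 <- redcop y) ((x ≺ y1) ⊗ y2) + x ⊗ y.
Proof. by rewrite redcop_prec /prec_rest !tliftD; congr (_ + _); rewrite addrAC. Qed.

Lemma prec_rest_linear (x1 x2 : A) : linear (fun y => prec_rest y x1 x2).
Proof.
move=> c y y'; rewrite /prec_rest linearP tlift_linear; last first.
  by split=> [y2 d y1 y1'|y1 d y2 y2'] /=; rewrite !linearPr ?linearPl.
by rewrite !linearPr linearPl scalerD3.
Qed.

Lemma prec_rest_bilinear (y : A) : bilinear_for *:%R *:%R (prec_rest y).
Proof.
split=> [x2 c x1 x1'|x1 c x2 x2'] /=; rewrite /prec_rest -scalerD3 -tliftP.
  rewrite !linearPl; congr (_ + _ + _).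
  by apply: eq_tlift => y1 y2; rewrite !linearPl.
rewrite linearPl !linearPr; congr (_ + _ + _).
by apply: eq_tlift => y1 y2; rewrite linearPl linearPr.
Qed.

End ReducedCoproduct.

(** * The solution [pi] of the convolution equation and the primitive elements *)

Section PrecEulerianIdempotent.
Set Implicit Arguments.
Unset Strict Implicit.
Context {k : fieldType} {A : nqshBialgType k}.
Variable pi : {linear A -> A}.
Hypothesis A_connected : connected A.
Hypothesis pi_eq : forall x : A, x = pi x + conv_prec pi idfun x.

Lemma pi_prec_bilinear : bilinear_for *:%R *:%R (fun a b : A => pi a ≺ b).
Proof.
by split=> [b c a a'|a c b b'] /=; rewrite ?linearPr // linearP linearPl.
Qed.

Lemma primitive_pi (x : A) : primitive (pi x).
Proof.
pose phi (t : (A ⊗ A)%type) (y : A) := - tlift (prec_rest y) t.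
apply: (@connected_recursion0 k A _ phi (redcop \o pi)) => //.
  split=> [y c t t'|t c y y'] /=; rewrite /phi.
    by rewrite tlift_linear ?opprD ?scalerN //; exact: prec_rest_bilinear.
  rewrite scalerN -opprD -tliftP; congr (- _).
  by apply: eq_tlift => x1 x2; rewrite prec_rest_linear.
move=> {}x; rewrite /phi tliftN /=; apply/eqP; rewrite -addr_eq0.
pose m : {bilinear A -> A -> A} := HB.pack (fun a b : A => pi a ≺ b)
  (bilinear_isBilinear.Build k A A A *:%R *:%R _ pi_prec_bilinear).
(* Apply [redcop] to the defining equation of [pi] and expand each [redcop (pi a ≺ b)]. *)
have := congr1 redcop (pi_eq x); rewrite linearD /conv_prec.
rewrite (linear_tlift (linearP redcop)).
rewrite (eq_tlift _ (fun a b => redcop_precE (pi a) b)) !tliftD.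
(* Coassociativity moves the product into the left leg, giving [conv_prec pi idfun a ⊗ b]. With the
   term [pi a ⊗ b] this sums to [a ⊗ b], so [redcop x] appears on both sides and cancels. *)
rewrite [X in _ + (_ + X + _)](redcop_coassoc_bilinear m).
rewrite -addrA -[in RHS]tliftD.
rewrite [X in _ + (_ + X)](_ : _ = redcop x); last first.
  rewrite -[RHS]tlift_tens; apply: eq_tlift => a b.
  by rewrite -linearDl addrC -pi_eq.
by rewrite addrA => /eqP; rewrite -subr_eq subrr eq_sym.
Qed.

Lemma pi_primitive (x : A) : primitive x -> pi x = x.
Proof.
move=> x0; rewrite [RHS]pi_eq /conv_prec x0 tlift0 ?addr0 //.
exact: pi_prec_bilinear.
Qed.

Lemma pi_prec_primitive (x y : A) : primitive x -> pi (x ≺ y) = 0.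
Proof.
move=> x0.
apply: (@connected_recursion0 k A _ (fun w b => - (w ≺ b)) (pi \o prec x)) => //.
  by split=> [b c w w'|w c b b'] /=;
    rewrite ?linearPl ?linearPr opprD scalerN.
move=> {}y; rewrite tliftN /=; apply/eqP; rewrite -addr_eq0.
(* As [redcop x] is zero, only [(x ≺ y1) ⊗ y2] and [x ⊗ y] survive. The latter contributes
   [pi x ≺ y], which is [x ≺ y] and cancels the left side. *)
have := pi_eq (x ≺ y); rewrite /conv_prec redcop_precE x0.
rewrite tlift0 ?add0r; last exact: prec_rest_bilinear.
rewrite tlift_additive; last exact: pi_prec_bilinear.
rewrite tliftE ?(pi_primitive x0); last exact: pi_prec_bilinear.
rewrite addrA => /eqP; rewrite -subr_eq subrr eq_sym.
rewrite (linear_tlift (tlift_linear pi_prec_bilinear)).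
rewrite (eq_tlift (g := fun y1 y2 => pi (x ≺ y1) ≺ y2)) // => y1 y2.
by rewrite tliftE //; exact: pi_prec_bilinear.
Qed.

End PrecEulerianIdempotent.

Theorem proposition27 (k : fieldType) (A : nqshBialgType k)
  (A_connected : connected A) (pi : {linear A -> A})
  (pi_eq : forall x : A, x = pi x + conv_prec pi idfun x) :
  projection_onto pi (@primitive k A)
  /\ (forall x y : A, primitive x -> pi (x ≺ y) = 0).
Proof.
have pi_prim x : primitive (pi x) by exact: primitive_pi.
split=> [|x y]; last exact: pi_prec_primitive.
(* Idempotence and the description of the image both follow from two facts: values of [pi] are
   primitive, and [pi] fixes primitives. *)
split=> x; first exact: pi_primitive.
by split=> [/(pi_primitive pi_eq) <-|[y ->//]]; exists x.
Qed.
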